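(* Let $X$ be an infinite-dimensional Banach space over $\mathbb{K}$ with a normalized unconditional Schauder basis $(x_n)$, let $m$ be a natural number and $q>0$. Let $\mu$ be the best $t$ such that $(x_n^*(x))_n\in\ell_t$ for each $x\in X$, where $(x_n^* )$ are the coefficient functionals of $(x_n)$. If $\mathcal{P}_{as(q;1)}(^mX)=\mathcal{P}(^mX)$, then (a) $\mu\le \frac{mq}{1-q}$ if $q<1$; (b) $\mu\le mq$ if $q\le \frac12$.
   Context: The scalar field $\mathbb{K}$ is either $\mathbb{R}$ or $\mathbb{C}$. ''The best $t$'' means $\mu=\inf\{t>0: (x_n^*(x))_n\in\ell_t \text{ for every } x\in X\}$ (with $\mu=\infty$ if there is no finite such $t$). $\mathcal{P}(^mX)$ is the Banach space of continuous $m$-homogeneous polynomials $P:X\to\mathbb{K}$. For a finite sequence $(y_j)_{j=1}^k$ in $X$ and $r>0$, $\|(y_j)_{j=1}^k\|_{w,r}=\sup_{\varphi\in B_{X'}}\left(\sum_{j=1}^k|\varphi(y_j)|^r\right)^{1/r}$, where $B_{X'}$ is the closed unit ball of the dual $X'$. A continuous $m$-homogeneous polynomial $P:X\to\mathbb{K}$ is absolutely $(p;r)$-summing if there is a constant $L\ge 0$ such that $\left(\sum_{j=1}^k|P(y_j)|^p\right)^{1/p}\le L\,\|(y_j)_{j=1}^k\|_{w,r}^m$ for every $k\in\mathbb{N}$ and all $y_1,\dots,y_k\in X$; the space of these is $\mathcal{P}_{as(p;r)}(^mX)$. (The notion is of interest for $p\ge r/m$; for $p<r/m$ only the zero polynomial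 satisfies the inequality.) *)

(* Defs.v *)
(* MathComp / MathComp-Analysis. *)
From HB Require Import structures.
From mathcomp Require Import all_boot all_order all_algebra.
From mathcomp Require Import all_classical all_reals all_analysis.
From mathcomp Require Import complex.

Set Implicit Arguments.
Unset Strict Implicit.
Unset Printing Implicit Defensive.

Import Order.TTheory GRing.Theory Num.Theory.
Import numFieldNormedType.Exports.

Local Open Scope classical_set_scope.
Local Open Scope ring_scope.

Variant scalar_kind := RealScalars | ComplexScalars.

Definition scalars (R : realType) (s : scalar_kind) : numFieldType :=
  match s with
  | RealScalars => R
  | ComplexScalars => R[i]
  end.

(* In a [numFieldType] K the norm [`|a|] is K-valued; [modulus] is the same
   quantity as an element of R, so that real powers of it can be taken. *)
Definition modulus (R : realType) (s : scalar_kind) : scalars R s -> R :=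
  match s return scalars R s -> R with
  | RealScalars => fun a : R => `|a|
  | ComplexScalars => fun a : R[i] => complex.Re `|a|
  end.

Section BanachSpace.
Context {R : realType} {s : scalar_kind}.
Local Notation K := (scalars R s).
Context {X : completeNormedModType K}.
Implicit Types (b : nat -> X) (x : X) (m : nat) (p r t q : R).

Definition ell t : set (nat -> K) :=
  [set a | cvgn (series (fun n => modulus (a n) `^ t))].

Definition unconditionally_cvg (u : nat -> X) : Prop :=
  forall g : nat -> nat, bijective g -> cvgn (series (u \o g)).

Definition is_expansion b x (a : nat -> K) : Prop :=
  series (fun n => a n *: b n) @ \oo --> x.

Definition schauder_basis b : Prop :=
  forall x, exists! a : nat -> K, is_expansion b x a.

(* [coef b n x] is the value at x of the n-th coefficient functional; it is
   meaningful only when b is a Schauder basis. *)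
Definition coef b (n : nat) (x : X) : K :=
  xget (fun=> 0) [set a : nat -> K | is_expansion b x a] n.

Definition unconditional_basis b : Prop :=
  schauder_basis b /\
  forall x, unconditionally_cvg (fun n => coef b n x *: b n).

(* The infimum is taken in the extended reals, so it is +oo if no t works. *)
Definition best_exponent b : \bar R :=
  ereal_inf [set t%:E | t in
    [set t : R | 0 < t /\ forall x, ell t (fun n => coef b n x)]].

Definition multilinear m (A : ('I_m -> X) -> K) : Prop :=
  forall (i : 'I_m) (v : 'I_m -> X),
    linear (fun x => A (fun j => if j == i then x else v j) : K^o).

(* P(^m X); for maps arising from an m-linear form, continuity of P on X is
   what makes the homogeneous polynomial continuous. *)
Definition polynomials m : set (X -> K) :=
  [set P | continuous P /\
    exists2 A : ('I_m -> X) -> K, multilinear A & forall x, P x = A (fun=> x)].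

Definition dual_ball : set {linear X -> K^o} :=
  [set f | continuous f /\ forall x, `|x| <= 1 -> `|f x| <= 1].

(* For r > 0 the supremum is over a nonempty set bounded above by
   (\sum_j ||y j|| ^ r) ^ (1 / r), so the real-valued [sup] is the right one. *)
Definition weak_norm r (k : nat) (y : 'I_k -> X) : R :=
  sup [set (\sum_(j < k) modulus (f (y j)) `^ r) `^ r^-1 | f in dual_ball].

Definition summing_polynomials m p r : set (X -> K) :=
  [set P | polynomials m P /\
    exists2 L : R, 0 <= L & forall (k : nat) (y : 'I_k -> X),
      (\sum_(j < k) modulus (P (y j)) `^ p) `^ p^-1 <= L * weak_norm r y ^+ m].

End BanachSpace.

Definition infinite_dimensional (R : realType) (s : scalar_kind)
    (X : completeNormedModType (scalars R s)) : Prop :=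
  ~ exists (n : nat) (e : 'I_n -> X), forall x : X,
      exists c : 'I_n -> scalars R s, x = \sum_(i < n) c i *: e i.

Arguments polynomials {R s} X m.
Arguments summing_polynomials {R s} X m p r.

(* Main.v *)
(* Every polynomial considered is diagonal: P x = sum_j nu_j x_j^m with
   nonnegative weights nu.  By Baire's theorem P is continuous as soon as its
   series converges absolutely at every point.  Testing the summing inequality
   on the vectors x_j b_j, whose weak l_1 norm is bounded by unconditionality,
   shows that sum_j (nu_j |x_j|^m)^q is finite.
   Any summable nu is allowed, since the coefficients of x are bounded; if
   sum_j |x_j|^(mq/(1-q)) diverged, the Abel-Dini choice of nu would make the
   former sum infinite.  If q <= 1/2 then mq/(1-q) <= m, so that
   sum_j |x_j|^m is finite for every x and nu = 1 is allowed as well, which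
   yields sum_j |x_j|^(mq). *)
Require Import Defs.
From HB Require Import structures.
From mathcomp Require Import all_boot all_order all_algebra.
From mathcomp Require Import all_classical all_reals all_analysis.
From mathcomp Require Import complex ring lra.
Import Order.TTheory GRing.Theory Num.Theory.
Import numFieldNormedType.Exports.
Local Open Scope classical_set_scope.
Local Open Scope ring_scope.
Set Implicit Arguments.
Unset Strict Implicit.
Unset Printing Implicit Defensive.

(** * Real and complex scalars treated uniformly *)

Section Scalars.
Context {R : realType} {s : scalar_kind}.
Local Notation K := (scalars R s).
Implicit Types (a c : K) (r : R).

Definition of_real : R -> K :=
  match s return R -> scalars R s with
  | RealScalars => id
  | ComplexScalars => real_complex R
  end.

Definition re_part : K -> R :=
  match s return scalars R s -> R with
  | RealScalars => id
  | ComplexScalars => @complex.Re R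
  end.

(** Constantly 0 over the reals, so that arguments by real and imaginary parts cover both fields at
    once. *)
Definition im_part : K -> R :=
  match s return scalars R s -> R with
  | RealScalars => fun=> 0
  | ComplexScalars => @complex.Im R
  end.

Lemma of_real_modulus a : `|a| = of_real (modulus a).
Proof. by rewrite /of_real; case: s a => //= -[x y]. Qed.

Lemma modulus_of_real r : modulus (of_real r) = `|r|.
Proof. by rewrite /of_real; case: s => //=; rewrite expr0n addr0 sqrtr_sqr. Qed.

Lemma of_realD : {morph of_real : x y / x + y}.
Proof. by rewrite /of_real; case: s => //= x y; rewrite rmorphD. Qed.

Lemma of_realM : {morph of_real : x y / x * y}.
Proof. by rewrite /of_real; case: s => //= x y; rewrite rmorphM. Qed.

Lemma of_real0 : of_real 0 = 0.
Proof. by rewrite /of_real; case: s. Qed.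

Lemma of_real1 : of_real 1 = 1.
Proof. by rewrite /of_real; case: s. Qed.

Lemma ler_of_real : {mono of_real : x y / x <= y}.
Proof. by rewrite /of_real; case: s => //= x y; rewrite lecR. Qed.

Lemma ltr_of_real : {mono of_real : x y / x < y}.
Proof. by rewrite /of_real; case: s => //= x y; rewrite ltcR. Qed.

Lemma of_real_inj : injective of_real.
Proof.
move=> x y xy; apply/eqP; rewrite eq_le -!ler_of_real xy lexx //.
Qed.

(** A positive scalar equals its own modulus, hence is real even in the complex case. This lets
    every [K]-valued tolerance be replaced by a real one. *)
Lemma gt0_of_real a : 0 < a -> exists2 r, 0 < r & a = of_real r.
Proof.
move=> a0; exists (modulus a); last by rewrite -of_real_modulus gtr0_norm.
by rewrite -ltr_of_real of_real0 -of_real_modulus normr_gt0 gt_eqF.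
Qed.

Lemma modulus_ge0 a : 0 <= modulus a.
Proof. by rewrite -ler_of_real of_real0 -of_real_modulus. Qed.

Lemma modulus0 : modulus (0 : K) = 0.
Proof. by apply: of_real_inj; rewrite -of_real_modulus normr0 of_real0. Qed.

Lemma modulus1 : modulus (1 : K) = 1.
Proof. by apply: of_real_inj; rewrite -of_real_modulus normr1 of_real1. Qed.

Lemma modulusM : {morph @modulus R s : x y / x * y}.
Proof.
by move=> x y; apply: of_real_inj; rewrite of_realM -!of_real_modulus normrM.
Qed.

Lemma modulusX a n : modulus (a ^+ n) = modulus a ^+ n.
Proof. by elim: n => [|n IH]; rewrite ?modulus1 // !exprS modulusM IH. Qed.

Lemma modulus_prod (I : Type) (l : seq I) (P : pred I) (F : I -> K) :
  modulus (\prod_(i <- l | P i) F i) = \prod_(i <- l | P i) modulus (F i).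
Proof. exact: (big_morph _ modulusM modulus1). Qed.

Lemma ler_modulus_re a : `|re_part a| <= modulus a.
Proof.
rewrite /re_part; case: s a => //= -[x y] /=.
by rewrite -sqrtr_sqr ler_sqrt ?addr_ge0 ?sqr_ge0// lerDl sqr_ge0.
Qed.

Lemma ler_modulus_im a : `|im_part a| <= modulus a.
Proof.
rewrite /im_part; case: s a => [/= a|[x y] /=]; first by rewrite normr0.
by rewrite -sqrtr_sqr ler_sqrt ?addr_ge0 ?sqr_ge0// lerDr sqr_ge0.
Qed.

Lemma modulus_re_im a : modulus a <= `|re_part a| + `|im_part a|.
Proof.
rewrite /re_part /im_part; case: s a => [/= a|[x y] /=].
  by rewrite normr0 addr0.
rewrite -[leRHS]ger0_norm ?addr_ge0// -sqrtr_sqr ler_sqrt ?sqr_ge0//.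
rewrite sqrrD !real_normK ?num_real// -addrA [_ *+ 2 + _]addrC addrA lerDl.
by rewrite mulrn_wge0// mulr_ge0.
Qed.

Lemma re_part_is_zmod_morphism : zmod_morphism re_part.
Proof. by rewrite /re_part; case: s => //= -[x y] [z t]. Qed.

Lemma im_part_is_zmod_morphism : zmod_morphism im_part.
Proof.
by rewrite /im_part; case: s => [x y /=|[x y] [z t]//]; rewrite subr0.
Qed.

HB.instance Definition _ :=
  GRing.isZmodMorphism.Build K R re_part re_part_is_zmod_morphism.
HB.instance Definition _ :=
  GRing.isZmodMorphism.Build K R im_part im_part_is_zmod_morphism.

Lemma im_part_real a : s = RealScalars -> im_part a = 0.
Proof. by rewrite /im_part; case: s a. Qed.

Lemma re_im_surj (x y : R) : (s = RealScalars -> y = 0) ->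
  exists a : K, re_part a = x /\ im_part a = y.
Proof.
rewrite /re_part /im_part; case: s => /= y0; first by exists x; rewrite y0.
by exists (x +i* y)%C.
Qed.

(** Split by the sign of [f j]: each half is, up to sign, a single subsum. *)
Lemma sum_norm_le_subsums (f : nat -> R) k (M : R) :
  (forall P : pred nat, `|\sum_(j < k | P j) f j| <= M) ->
  \sum_(j < k) `|f j| <= M *+ 2.
Proof.
move=> subM; rewrite (bigID (fun j : 'I_k => 0 <= f j)) /= mulr2n.
apply: lerD.
  apply: le_trans (subM (fun j => 0 <= f j)); apply: le_trans (ler_norm _).
  by apply: ler_sum => j fj; rewrite ger0_norm.
apply: le_trans (subM (fun j => ~~ (0 <= f j))).
rewrite -normrN -sumrN; apply: le_trans (ler_norm _).
by apply: ler_sum => j; rewrite -ltNge => fj; rewrite ltr0_norm.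
Qed.

(** The factor 4 counts the two signs of the real part and of the imaginary part. *)
Lemma sum_modulus_le_subsums (f : nat -> K) k (M : R) :
  (forall P : pred nat, modulus (\sum_(j < k | P j) f j) <= M) ->
  \sum_(j < k) modulus (f j) <= M *+ 4.
Proof.
move=> subM.
apply: (@le_trans _ _ (\sum_(j < k) (`|re_part (f j)| + `|im_part (f j)|))).
  by apply: ler_sum => j _; apply: modulus_re_im.
rewrite big_split /= -[4%N]/(2 + 2)%N mulrnDr.
apply: lerD.
  apply: (@sum_norm_le_subsums (re_part \o f)) => P /=.
  by apply: le_trans (subM P); rewrite -raddf_sum ler_modulus_re.
apply: (@sum_norm_le_subsums (im_part \o f)) => P /=.
by apply: le_trans (subM P); rewrite -raddf_sum ler_modulus_im.
Qed.

End Scalars.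

(** * The norm as a real number, and its topology *)

Section RealNorm.
Context {R : realType} {s : scalar_kind}.
Local Notation K := (scalars R s).

Definition rnorm {V : normedModType K} (x : V) : R := modulus `|x|.

Context {V : normedModType K}.
Implicit Types (x y : V) (a : K).

Lemma rnormE x : `|x| = of_real (rnorm x).
Proof. by rewrite -of_real_modulus normr_id. Qed.

Lemma rnorm_ge0 x : 0 <= rnorm x.
Proof. exact: modulus_ge0. Qed.

Lemma rnorm0 : rnorm (0 : V) = 0.
Proof. by rewrite /rnorm normr0 modulus0. Qed.

Lemma rnorm_eq0 x : rnorm x = 0 -> x = 0.
Proof. by move=> x0; apply: normr0_eq0; rewrite rnormE x0 of_real0. Qed.

Lemma rnormN x : rnorm (- x) = rnorm x.
Proof. by rewrite /rnorm normrN. Qed.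

Lemma rnormB x y : rnorm (x - y) = rnorm (y - x).
Proof. by rewrite /rnorm distrC. Qed.

Lemma rnormD x y : rnorm (x + y) <= rnorm x + rnorm y.
Proof. by rewrite -(ler_of_real (s := s)) of_realD -!rnormE ler_normD. Qed.

Lemma rnormDB z x y : rnorm (x - y) <= rnorm (x - z) + rnorm (z - y).
Proof. by rewrite -(subrKA z) rnormD. Qed.

Lemma rnormZ a x : rnorm (a *: x) = modulus a * rnorm x.
Proof.
rewrite /rnorm normrZ modulusM of_real_modulus modulus_of_real.
by rewrite ger0_norm ?modulus_ge0.
Qed.

Lemma rnorm_sum (I : Type) (l : seq I) (P : pred I) (F : I -> V) :
  rnorm (\sum_(i <- l | P i) F i) <= \sum_(i <- l | P i) rnorm (F i).
Proof.
elim/big_ind2: _ => [|x u y v xu yv|//]; first by rewrite rnorm0.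
exact: le_trans (rnormD _ _) (lerD xu yv).
Qed.

End RealNorm.

Section RealNormTopology.
Context {R : realType} {s : scalar_kind}.
Local Notation K := (scalars R s).
Context {V : normedModType K}.
Implicit Types (x y : V) (a : K).

Lemma rnorm_cvgP (u : nat -> V) x : u @ \oo --> x <->
  forall e : R, 0 < e -> exists N, forall n, (N <= n)%N -> rnorm (u n - x) <= e.
Proof.
split=> [/cvgrPdist_le ux e e0|ux].
  have /ux[N _ uN] : 0 < of_real e :> K by rewrite -of_real0 ltr_of_real.
  exists N => n /uN /=.
  by rewrite rnormE ler_of_real rnormB.
apply/cvgrPdist_le => _ /gt0_of_real[e e0 ->].
have [N uN] := ux e e0; exists N => // n /uN /=.
by rewrite rnormE ler_of_real rnormB.
Qed.

Lemma rnorm_continuousP (W : normedModType K) (f : V -> W) x :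
  {for x, continuous f} <->
  forall e : R, 0 < e -> exists2 d : R, 0 < d &
    forall y, rnorm (x - y) <= d -> rnorm (f x - f y) <= e.
Proof.
split=> [/cvgrPdist_le fx e e0|fx].
  have /fx : 0 < of_real e :> K by rewrite -of_real0 ltr_of_real.
  move=> /nbhs_normP[_ /gt0_of_real[d d0 ->] /= sub].
  (* Halving [d] passes from the strict inequality of open balls to the large one. *)
  exists (d / 2); first by rewrite divr_gt0.
  move=> y xy; rewrite -(ler_of_real (s := s)) -rnormE; apply: sub.
  rewrite /ball_ /= rnormE ltr_of_real; apply: le_lt_trans xy _.
  by rewrite ltr_pdivrMr// ltr_pMr// ltr1n.
apply/cvgrPdist_le => _ /gt0_of_real[e e0 ->].
have [d d0 dP] := fx e e0; apply/nbhs_normP.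
exists (of_real d) => /=; first by rewrite -of_real0 ltr_of_real.
move=> y; rewrite /ball_ /= !rnormE ltr_of_real ler_of_real => /ltW; exact: dP.
Qed.

Lemma cvg_rnorm_le (u : nat -> V) x y (C : R) (N : nat) : u @ \oo --> x ->
  (forall n, (N <= n)%N -> rnorm (u n - y) <= C) -> rnorm (x - y) <= C.
Proof.
move=> /rnorm_cvgP ux uC; apply/ler_addgt0Pr => e e0.
have [M uM] := ux e e0; rewrite [C + e]addrC.
apply: le_trans (rnormDB (u (maxn N M)) _ _) _; rewrite lerD//.
  by rewrite rnormB uM// leq_maxr.
by rewrite uC// leq_maxl.
Qed.

Lemma cvg_rnorm_bounded (u : nat -> V) : cvgn u ->
  exists2 M : R, 0 <= M & forall n, rnorm (u n) <= M.
Proof.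
move=> /cvg_ex[x /rnorm_cvgP/(_ 1 ltr01)[N uN]].
exists (1 + rnorm x + \sum_(n < N) rnorm (u n)).
  by rewrite !addr_ge0 ?rnorm_ge0 ?sumr_ge0// => n _; apply: rnorm_ge0.
move=> n; have [Nn|nN] := leqP N n.
  rewrite -[leLHS]addr0 lerD ?sumr_ge0//; last by move=> j _; apply: rnorm_ge0.
  rewrite -[u n](subrK x); apply: le_trans (rnormD _ _) _.
  by rewrite lerD2r uN.
rewrite -[leLHS]add0r lerD ?addr_ge0 ?rnorm_ge0//.
rewrite (bigD1 (Ordinal nN))//= lerDl sumr_ge0// => j _; exact: rnorm_ge0.
Qed.

End RealNormTopology.

Lemma rnorm_scalar (R : realType) (s : scalar_kind) (a : (scalars R s)^o) :
  rnorm a = modulus (a : scalars R s).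
Proof.
rewrite -[a in LHS]mulr1 [a * 1]/(a *: (1 : _^o)) rnormZ.
by rewrite /rnorm normr1 modulus1 mulr1.
Qed.

(** * Completeness of the space and of the scalar field *)

Lemma rnorm_complete (R : realType) (s : scalar_kind)
    (X : completeNormedModType (scalars R s)) (u : nat -> X) :
  (forall e : R, 0 < e -> exists N, forall m n, (N <= m)%N -> (N <= n)%N ->
     rnorm (u m - u n) <= e) -> cvgn u.
Proof.
move=> uC; apply: cauchy_cvg; apply: cauchy_exP => _ /gt0_of_real[e e0 ->].
have [N uN] := uC (e / 2) (divr_gt0 e0 (ltr0Sn _ 1)).
exists (u N), N => // n /= Nn; rewrite -ball_normE /ball_ /= rnormE ltr_of_real.
apply: le_lt_trans (uN _ _ (leqnn N) Nn) _.
by rewrite ltr_pdivrMr// ltr_pMr// ltr1n.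
Qed.

(** Real and imaginary parts are Cauchy in [R]; their limits are reassembled into one scalar. *)
Lemma scalars_complete (R : realType) (s : scalar_kind)
    (u : nat -> (scalars R s)^o) :
  (forall e : R, 0 < e -> exists N, forall m n, (N <= m)%N -> (N <= n)%N ->
     rnorm (u m - u n) <= e) -> cvgn u.
Proof.
move=> uC.
have real_cvg (f : {additive scalars R s -> R}) :
    (forall a, `|f a| <= modulus a) -> cvgn (f \o u : nat -> R^o).
  move=> fle; apply: (@rnorm_complete R RealScalars R^o) => e e0.
  have [N uN] := uC e e0; exists N => m n Nm Nn.
  apply: le_trans (uN m n Nm Nn); rewrite rnorm_scalar.
  rewrite (@rnorm_scalar R RealScalars) /= -raddfB.
  exact: fle.
have /cvg_ex[x ux] := real_cvg _ (@ler_modulus_re R s).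
have /cvg_ex[y uy] := real_cvg _ (@ler_modulus_im R s).
(* Over the reals all imaginary parts vanish, hence so does their limit, as [re_im_surj]
   requires. *)
have y0 : s = RealScalars -> y = 0.
  move=> s0; rewrite -[y]subr0; apply: (@rnorm_eq0 R RealScalars R^o).
  apply/le_anti; rewrite rnorm_ge0 andbT.
  apply: (@cvg_rnorm_le R RealScalars R^o _ _ 0 0 0%N uy) => n _ /=.
  by rewrite im_part_real// subrr /rnorm /= !normr0.
have [a [ax ay]] := re_im_surj x y0.
apply/cvg_ex; exists a; apply/rnorm_cvgP => e e0.
have e2 : 0 < e / 2 by rewrite divr_gt0.
have /(@rnorm_cvgP R RealScalars R^o)/(_ _ e2)[N1 h1] := ux.
have /(@rnorm_cvgP R RealScalars R^o)/(_ _ e2)[N2 h2] := uy.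
exists (maxn N1 N2) => n; rewrite geq_max => /andP[n1 n2].
rewrite rnorm_scalar; apply: le_trans (modulus_re_im _) _.
rewrite [leRHS](splitr e) !raddfB/= ax ay lerD//.
  by have := h1 n n1; rewrite (@rnorm_scalar R RealScalars).
by have := h2 n n2; rewrite (@rnorm_scalar R RealScalars).
Qed.

Lemma exists_half_pow_le (R : realType) (e : R) : 0 < e ->
  exists N, 2^-1 ^+ N <= e.
Proof.
move=> e0; exists (Num.bound e^-1).
rewrite exprVn -[leRHS]invrK lef_pV2 ?posrE ?invr_gt0 ?exprn_gt0//.
by apply/ltW/upper_nthrootP.
Qed.

(** * Baire's theorem *)

Section Baire.
Context {R : realType} {s : scalar_kind}.
Context {X : completeNormedModType (scalars R s)}.

(** Otherwise there are nested closed balls of radius tending to 0, the ball of index [n.+1] missing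
    [A n], and the limit of their centres lies in no [A k]. Density in a ball is what can be used
    before the partial sums are known to be continuous. *)
Lemma rnorm_baire (A : nat -> set X) : (forall x, exists k, A k x) ->
  exists k x0 (d : R), 0 < d /\ forall x, rnorm (x - x0) <= d ->
    forall e : R, 0 < e -> exists2 a, A k a & rnorm (x - a) <= e.
Proof.
move=> cover; apply: contrapT => nodense.
have far k x0 (d : R) : 0 < d -> exists x, rnorm (x - x0) <= d /\
    exists2 e : R, 0 < e & forall a, A k a -> ~~ (rnorm (x - a) <= e).
  move=> d0; apply: contrapT => nofar; apply: nodense.
  exists k, x0, d; split=> // x xd e e0; apply: contrapT => noa; apply: nofar.
  exists x; split=> //; exists e => // a Aka; apply/negP => ae.
  by apply: noa; exists a.
(* A ball is a pair of centre and radius. Positivity of the radius is a premise inside the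
   existential, so that [choice] yields a total function; [(x0, d)] is a dummy value otherwise. *)
have step (p : nat * (X * R)) : exists z : X * R, 0 < p.2.2 ->
    [/\ 0 < z.2, z.2 <= p.2.2 / 2, rnorm (z.1 - p.2.1) <= p.2.2 / 2 &
        forall a, A p.1 a -> ~~ (rnorm (z.1 - a) <= z.2)].
  case: p => k [x0 d] /=; have [d0|_] := ltP 0 d; last by exists (x0, d).
  have [x [xd [e e0 eA]]] := far k x0 (d / 2) (divr_gt0 d0 (ltr0Sn _ 1)).
  exists (x, Num.min e (d / 2)) => _ /=; split=> //.
  - by rewrite lt_min e0 divr_gt0.
  - by rewrite ge_min lexx orbT.
  - by move=> a /eA; apply: contra; rewrite le_min => /andP[].
have [f fP] := choice step.
pose z := fix z n := if n is k.+1 then f (k, z k) else (0 : X, 1 : R).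
have z_gt0 n : 0 < (z n).2 by elim: n => //= n /(fP (n, z n)) [].
have zS n : [/\ (z n.+1).2 <= (z n).2 / 2,
    rnorm ((z n.+1).1 - (z n).1) <= (z n).2 / 2 &
    forall a, A n a -> ~~ (rnorm ((z n.+1).1 - a) <= (z n.+1).2)].
  by have [] := fP (n, z n) (z_gt0 n).
have z_half n : (z n).2 <= 2^-1 ^+ n.
  elim: n => [|n IH] //; have [h _ _] := zS n; apply: le_trans h _.
  by rewrite exprSr ler_pM2r ?invr_gt0.
(* Each centre moves by at most half the radius, which is at most the decrease of the radius, so the
   bounds telescope. *)
have z_dist n m : (n <= m)%N -> rnorm ((z m).1 - (z n).1) <= (z n).2 - (z m).2.
  elim: m => [|m IH]; first by rewrite leqn0 => /eqP ->; rewrite !subrr rnorm0.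
  rewrite leq_eqVlt => /orP[/eqP <-|/IH le_m]; first by rewrite !subrr rnorm0.
  have [h1 h2 _] := zS m; apply: le_trans (rnormDB (z m).1 _ _) _; lra.
have z_ball n m : (n <= m)%N -> rnorm ((z m).1 - (z n).1) <= (z n).2.
  by move=> nm; have := z_dist n m nm; have := z_gt0 m; lra.
have /cvg_ex[x zx] : cvgn (fun n => (z n).1).
  apply: rnorm_complete => e e0.
  have [N hN] := exists_half_pow_le (divr_gt0 e0 (ltr0Sn _ 1)).
  exists N => m n Nm Nn; apply: le_trans (rnormDB (z N).1 _ _) _.
  have := z_ball N m Nm; have := z_ball N n Nn; have := z_half N.
  rewrite [rnorm (_ - (z n).1)]rnormB; lra.
have [k Akx] := cover x; have [_ _ /(_ x Akx)] := zS k.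
by rewrite rnormB (cvg_rnorm_le (N := k.+1) zx)// => n; apply: z_ball.
Qed.

End Baire.

(** * Continuity of the partial sums and coefficients of a Schauder basis *)

Section SchauderBasis.
Context {R : realType} {s : scalar_kind}.
Local Notation K := (scalars R s).
Context {X : completeNormedModType K}.
Variable b : nat -> X.
Hypothesis b_basis : schauder_basis b.
Hypothesis b_normalized : forall n, `|b n| = 1.

Lemma rnorm_basis n : rnorm (b n) = 1.
Proof. by rewrite /rnorm b_normalized modulus1. Qed.

Lemma coef_expansion x : is_expansion b x (fun n => coef b n x).
Proof.
have [a [ax _]] := b_basis x.
exact: (@xgetPex _ _ [set a : nat -> K | is_expansion b x a]) (ex_intro _ a ax).
Qed.

Lemma coef_unique x a : is_expansion b x a -> forall n, coef b n x = a n.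
Proof.
move=> ax n; have [c [_ c_uniq]] := b_basis x.
by rewrite -(c_uniq _ ax) (c_uniq _ (@coef_expansion x)).
Qed.

Lemma coef_linear n : linear (coef b n : X -> K^o).
Proof.
move=> c x y.
apply: (@coef_unique _ (fun n => c * coef b n x + coef b n y)).
rewrite /is_expansion (_ : series _ =
    (fun N => c *: series (fun n => coef b n x *: b n) N +
              series (fun n => coef b n y *: b n) N)); last first.
  apply/funext => N; rewrite /series /= scaler_sumr -big_split /=.
  by apply: eq_bigr => k _; rewrite scalerDl scalerA.
apply: cvgD; last exact: coef_expansion.
by apply: cvgZr; apply: coef_expansion.
Qed.

HB.instance Definition _ n :=
  GRing.isLinear.Build K X K^o _ (coef b n) (coef_linear n).

Lemma coef_basis n k : coef b n (b k) = (n == k)%:R.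
Proof.
apply: (@coef_unique _ (fun n => (n == k)%:R)).
apply/rnorm_cvgP => e e0; exists k.+1 => N kN.
rewrite /series /= big_mkord (bigD1 (Ordinal kN))//= eqxx scale1r big1.
  by rewrite addr0 subrr rnorm0 ltW.
by move=> i; rewrite -val_eqE /= => /negPf ->; rewrite scale0r.
Qed.

Lemma coef_funD n x y : coef b n (x + y) = coef b n x + coef b n y.
Proof. exact: linearD. Qed.

Lemma coef_funB n x y : coef b n (x - y) = coef b n x - coef b n y.
Proof. exact: linearB. Qed.

Lemma coef_funZ n a x : coef b n (a *: x) = a * coef b n x.
Proof. exact: linearZ. Qed.

Lemma coefZ_basis n k a : coef b n (a *: b k) = a * (n == k)%:R.
Proof. by rewrite linearZ /= coef_basis. Qed.

Definition partial_sum N x : X := \sum_(n < N) coef b n x *: b n.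

Lemma partial_sum_is_linear N : linear (partial_sum N).
Proof.
move=> c x y; rewrite /partial_sum scaler_sumr -big_split /=.
by apply: eq_bigr => k _; rewrite linearP scalerDl scalerA.
Qed.

HB.instance Definition _ N :=
  GRing.isLinear.Build K X X _ (partial_sum N) (partial_sum_is_linear N).

Lemma cvg_partial_sum x : partial_sum ^~ x @ \oo --> x.
Proof.
have := @coef_expansion x; rewrite /is_expansion.
rewrite (_ : series _ = partial_sum ^~ x)//.
by apply/funext => N; rewrite /series /= big_mkord.
Qed.

Lemma partial_sumS N x :
  partial_sum N.+1 x = partial_sum N x + coef b N x *: b N.
Proof. by rewrite /partial_sum big_ord_recr. Qed.

(** By Baire, the points whose partial sums are all bounded by some [k] are dense in a ball of
    radius [d] about [x0]. With [t = d / rnorm x], let such points [a1] and [a2] approximate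
    [x0 + t x] and [x0]: then [(a1 - a2) / t] approximates [x], with partial sums at most
    [2k / t]. *)
Lemma partial_sum_approx : exists2 M : R, 0 <= M & forall x (e : R), 0 < e ->
  exists a, (forall N, rnorm (partial_sum N a) <= M * rnorm x) /\
            rnorm (x - a) <= e.
Proof.
pose A k := [set x | forall N, rnorm (partial_sum N x) <= k%:R :> R].
have cover x : exists k, A k x.
  have [M M0 xM] : exists2 M : R, 0 <= M &
      forall N, rnorm (partial_sum N x) <= M.
    by apply: cvg_rnorm_bounded; apply/cvg_ex; exists x; apply: cvg_partial_sum.
  by exists (Num.bound M) => N; apply: le_trans (xM N) (ltW (archi_boundP M0)).
have [k [x0 [d [d0 near]]]] := rnorm_baire cover.
exists (k.*2%:R / d) => [|x e e0]; first by rewrite divr_ge0// ltW.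
have [x_eq0|x_neq0] := eqVneq (rnorm x) 0.
  exists 0; split=> [N|]; first by rewrite linear0 rnorm0 x_eq0 mulr0.
  by rewrite subr0 x_eq0 ltW.
have x_gt0 : 0 < rnorm x by rewrite lt_neqAle eq_sym x_neq0 rnorm_ge0.
pose t := d / rnorm x; have t0 : 0 < t by rewrite divr_gt0.
have te0 : 0 < t * e / 2 by rewrite divr_gt0// mulr_gt0.
have modt r : 0 < r -> modulus (of_real r : K) = r.
  by move=> r0; rewrite modulus_of_real gtr0_norm.
have [|a1 Aa1 xa1] := near (x0 + of_real t *: x) _ _ te0.
  by rewrite addrC addKr rnormZ modt// divfK.
have [|a2 Aa2 xa2] := near x0 _ _ te0; first by rewrite subrr rnorm0 ltW.
exists (of_real t^-1 *: (a1 - a2)); split=> [N|].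
  rewrite linearZ/= rnormZ modt ?invr_gt0// linearB/=.
  have -> : k.*2%:R / d * rnorm x = t^-1 * k.*2%:R.
    by rewrite /t invf_div -mulrA mulrC [d^-1 * _]mulrC.
  rewrite ler_wpM2l ?invr_ge0 ?(ltW t0)//.
  apply: le_trans (rnormD _ _) _; rewrite rnormN -addnn natrD.
  by rewrite lerD.
have -> : x = of_real t^-1 *: (of_real t *: x).
  by rewrite scalerA -of_realM mulVf ?gt_eqF// of_real1 scale1r.
rewrite -scalerBr rnormZ modt ?invr_gt0// mulrC ler_pdivrMr// [e * t]mulrC.
rewrite [leRHS]splitr.
have -> : of_real t *: x - (a1 - a2) = (x0 + of_real t *: x - a1) - (x0 - a2).
  by rewrite -[x0 + _ - a1]addrA !opprD !opprK addrACA subrr add0r addrA.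
by apply: le_trans (rnormD _ _) _; rewrite rnormN lerD.
Qed.

(* The partial sums of [x] are not yet known to be continuous in [x], so they
   are estimated on a series of approximants converging to [x], whose partial
   sums are small; uniqueness of the expansion of 0 carries the bound to [x]. *)
Lemma partial_sum_bounded : exists2 C : R, 0 <= C & forall N x,
  rnorm (partial_sum N x) <= C * rnorm x.
Proof.
have [M M0 approx] := partial_sum_approx.
exists (M *+ 2) => [|N x]; first by rewrite mulrn_wge0.
have [x_eq0|x_neq0] := eqVneq (rnorm x) 0.
  by rewrite (rnorm_eq0 x_eq0) linear0 rnorm0 mulr0.
have x_gt0 : 0 < rnorm x by rewrite lt_neqAle eq_sym x_neq0 rnorm_ge0.
pose h i : R := 2^-1 ^+ i * rnorm x.
have h_gt0 i : 0 < h i by rewrite mulr_gt0// exprn_gt0// invr_gt0.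
have hS i : h i = h i.+1 *+ 2.
  by rewrite /h exprS; move: (_ ^+ i) => p; rewrite mulr2n; lra.
have step (p : nat * X) : exists a,
    (forall N, rnorm (partial_sum N a) <= M * rnorm p.2) /\
    rnorm (p.2 - a) <= h p.1.+1 by apply: approx.
have [f fP] := choice step.
(* [w i] is what remains of [x] after subtracting [i] approximants. *)
pose w := fix w i := if i is j.+1 then w j - f (j, w j) else x.
have w_le i : rnorm (w i) <= h i.
  case: i => [|i]; first by rewrite /h expr0 mul1r.
  by have [_] := fP (i, w i).
(* Step [j] costs at most [M * h j], which is [2 * M * (h j - h j.+1)], so the bounds telescope. *)
have w_dist n i j : (i <= j)%N ->
    rnorm (partial_sum n (w j) - partial_sum n (w i)) <= M *+ 2 * (h i - h j).
  elim: j => [|j IH].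
    by rewrite leqn0 => /eqP ->; rewrite !subrr rnorm0 mulr0.
  rewrite leq_eqVlt => /orP[/eqP <-|/IH le_j].
    by rewrite !subrr rnorm0 mulr0.
  apply: le_trans (rnormDB (partial_sum n (w j)) _ _) _.
  have -> : partial_sum n (w j.+1) - partial_sum n (w j) =
            - partial_sum n (f (j, w j)).
    by rewrite -linearB /= addrC addKr linearN.
  rewrite rnormN; have [/(_ n) le1 _] := fP (j, w j).
  have := ler_wpM2l M0 (w_le j); have := hS j; rewrite !mulr2n /= in le1 le_j *.
  nra.
have w_ball n i j : (i <= j)%N ->
    rnorm (partial_sum n (w j) - partial_sum n (w i)) <= M *+ 2 * h i.
  move=> ij; apply: le_trans (w_dist n i j ij) _.
  by rewrite ler_wpM2l ?mulrn_wge0// gerBl ltW.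
have h_small c (e : R) : 0 <= c -> 0 < e -> exists i, c * h i <= e.
  move=> c0 e0; have c1 : 0 < (c + 1) * rnorm x by rewrite mulr_gt0// ltr_wpDl.
  have [i hi] := exists_half_pow_le (divr_gt0 e0 c1); exists i.
  move: hi; rewrite ler_pdivlMr// mulrCA -/(h i).
  by apply: le_trans; rewrite ler_wpM2r ?lerDl// ltW.
have w_close n I i j : (I <= i)%N -> (I <= j)%N ->
    rnorm (partial_sum n (w i - w j)) <= M *+ 4 * h I.
  move=> Ii Ij; rewrite linearB /=.
  apply: le_trans (rnormDB (partial_sum n (w I)) _ _) _.
  rewrite -[4%N]/(2 + 2)%N mulrnDr mulrDl lerD ?w_ball//.
  by rewrite rnormB w_ball.
have coefE n y : coef b n y *: b n = partial_sum n.+1 y - partial_sum n y.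
  by rewrite partial_sumS addrC addKr.
have coef_cvg n : cvgn (fun i => coef b n (w i) : K^o).
  apply: scalars_complete => e e0.
  have [I hI] := h_small (M *+ 8) e (mulrn_wge0 8 M0) e0; exists I.
  move=> i j Ii Ij; apply: le_trans hI.
  rewrite rnorm_scalar -[leLHS]mulr1 -(rnorm_basis n) -rnormZ -linearB coefE.
  apply: le_trans (rnormD _ _) _.
  by rewrite rnormN -[8%N]/(4 + 4)%N mulrnDr mulrDl lerD ?w_close.
(* The remainders [w i] tend to 0, but their coefficients are so far only known to converge; [beta]
   is shown to expand 0, hence to vanish. *)
pose beta n := limn (fun i => coef b n (w i) : K^o) : K.
pose T n := \sum_(k < n) beta k *: b k.
have w_T n : (fun i => partial_sum n (w i)) @ \oo --> T n.
  rewrite /T /partial_sum; elim: n => [|n IH].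
    under eq_fun do rewrite big_ord0.
    by rewrite big_ord0; apply: cvg_cst.
  under eq_fun do rewrite big_ord_recr /=.
  rewrite big_ord_recr /=; apply: cvgD IH _.
  exact: cvgZr_tmp (coef_cvg n).
have T_w n i : rnorm (T n - partial_sum n (w i)) <= M *+ 2 * h i.
  by apply: (cvg_rnorm_le (N := i) (w_T n)) => j ij; apply: w_ball.
have T_cvg0 : is_expansion b 0 beta.
  rewrite /is_expansion; apply/rnorm_cvgP => e e0.
  (* First [i] is chosen, making [T n - partial_sum n (w i)] and [w i] small uniformly in [n]; then
     [n] is taken large for this fixed [w i]. *)
  have M1_ge0 : 0 <= M *+ 2 + 1 by rewrite addr_ge0 ?mulrn_wge0.
  have [i hi] := h_small _ _ M1_ge0 (divr_gt0 e0 (ltr0Sn _ 1)).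
  have /rnorm_cvgP/(_ _ (divr_gt0 e0 (ltr0Sn _ 1)))[n0 hn0] :=
    @cvg_partial_sum (w i).
  exists n0 => n n0n; rewrite /series /= big_mkord -/(T n) subr0.
  have -> : T n =
      (T n - partial_sum n (w i)) + (partial_sum n (w i) - w i) + w i.
    by rewrite addrA subrK subrK.
  apply: le_trans (rnormD _ _) _.
  have := rnormD (T n - partial_sum n (w i)) (partial_sum n (w i) - w i).
  have := T_w n i; have := w_le i; have := hn0 n n0n.
  rewrite mulrDl mul1r in hi; lra.
have T0 : T N = 0.
  rewrite /T big1// => k _; rewrite -(@coef_unique _ _ T_cvg0).
  by rewrite linear0 scale0r.
(* At [i = 0] the remainder is [x] itself. *)
by have := T_w N 0%N; rewrite T0 sub0r rnormN /h expr0 mul1r.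
Qed.

Lemma coef_bounded : exists2 C : R, 0 <= C & forall n x,
  modulus (coef b n x) <= C * rnorm x.
Proof.
have [C C0 sumC] := partial_sum_bounded.
exists (C *+ 2) => [|n x]; first by rewrite mulrn_wge0.
rewrite -[leLHS]mulr1 -(rnorm_basis n) -rnormZ.
have -> : coef b n x *: b n = partial_sum n.+1 x - partial_sum n x.
  by rewrite partial_sumS addrC addKr.
apply: le_trans (rnormD _ _) _.
by rewrite rnormN mulr2n mulrDl lerD.
Qed.

End SchauderBasis.

(** * Unconditional convergence bounds all finite subsums *)

Section UnconditionalConvergence.
Context {R : realType} {s : scalar_kind}.
Local Notation K := (scalars R s).
Context {X : completeNormedModType K}.

Section BlockRearrangement.
Variables (next : nat -> nat) (P : nat -> pred nat).
Hypothesis lt_next : forall N, (N < next N)%N.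

Let start i := iter i next 0%N.

Let front N := [seq j <- index_iota N (next N) | P N j].
Let back N := [seq j <- index_iota N (next N) | ~~ P N j].

Let listing := fix listing i :=
  if i is j.+1 then listing j ++ (front (start j) ++ back (start j))
  else [::].

(** [listing n.+1] has at least [n.+1] entries, so position [n] is filled, and later listings only
    extend it. *)
Let rearrangement n := nth 0%N (listing n.+1) n.

Let le_start i : (i <= start i)%N.
Proof. by elim: i => // i IH; apply: leq_ltn_trans IH (lt_next _). Qed.

Let perm_listing i : perm_eq (listing i) (iota 0 (start i)).
Proof.
elim: i => //= i IH; rewrite -(subnKC (ltnW (lt_next (start i)))) iotaD.
by apply: perm_cat => //; rewrite add0n; apply/permPl/perm_filterC.
Qed.

Let size_listing i : size (listing i) = start i.
Proof. by rewrite (perm_size (perm_listing i)) size_iota. Qed.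

Let nth_listing i j n : (i <= j)%N -> (n < start i)%N ->
  nth 0%N (listing j) n = nth 0%N (listing i) n.
Proof.
move=> + ni; elim: j => [|j IH]; first by rewrite leqn0 => /eqP ->.
rewrite leq_eqVlt ltnS => /orP[/eqP -> //|le_ij].
rewrite /= nth_cat IH// size_listing ifT//; apply: leq_trans ni _.
elim: {IH} j le_ij => [|j IH]; first by rewrite leqn0 => /eqP ->.
rewrite leq_eqVlt ltnS => /orP[/eqP -> //|/IH h].
by apply: leq_trans h (ltnW (lt_next _)).
Qed.

Let rearrangementE i n : (n < start i)%N ->
  rearrangement n = nth 0%N (listing i) n.
Proof.
move=> ni; rewrite /rearrangement -(nth_listing (leq_maxl n.+1 i)) ?le_start//.
by rewrite (nth_listing (leq_maxr n.+1 i)).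
Qed.

Let rearrangement_bij : bijective rearrangement.
Proof.
pose inv v := index v (listing v.+1).
have inv_lt v : (inv v < start v.+1)%N.
  rewrite -size_listing index_mem (perm_mem (perm_listing _)) mem_iota.
  exact: le_start.
have invK : cancel inv rearrangement.
  move=> v; rewrite (rearrangementE (inv_lt v)) nth_index//.
  by rewrite -index_mem size_listing inv_lt.
have inj : injective rearrangement.
  move=> m n; pose i := maxn m.+1 n.+1.
  have mi : (m < start i)%N by apply: leq_trans (le_start i); apply: leq_maxl.
  have ni : (n < start i)%N by apply: leq_trans (le_start i); apply: leq_maxr.
  rewrite (rearrangementE mi) (rearrangementE ni) => /eqP.
  rewrite nth_uniq ?size_listing//; first by move/eqP.
  by rewrite (perm_uniq (perm_listing i)) iota_uniq.
by exists inv => //; apply: inj_can_sym invK inj.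
Qed.

(* Inside each block [start i, start i.+1) the indices satisfying [P] are listed
   first, so that the subsum over them is a difference of two partial sums of
   the rearranged series. *)
Lemma block_rearrangement (u : nat -> X) : exists g : nat -> nat, bijective g /\
  forall i, exists m n, [/\ (i <= m)%N, (i <= n)%N & exists N,
    series (u \o g) n - series (u \o g) m = \sum_(N <= j < next N | P N j) u j].
Proof.
exists rearrangement; split=> // i.
have seriesE n : (n <= start i.+1)%N ->
    series (u \o rearrangement) n = \sum_(j <- take n (listing i.+1)) u j.
  move=> ni; rewrite (big_nth 0%N) size_take_min size_listing (minn_idPl ni).
  rewrite /series /=; apply: eq_big_nat => k /andP[_ kn].
  by rewrite nth_take// (rearrangementE (leq_trans kn ni)).
exists (start i), (start i + size (front (start i)))%N.
split; [exact: le_start | exact: leq_trans (le_start i) (leq_addr _ _)|].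
exists (start i); rewrite !seriesE; last 2 first.
- exact: ltnW (lt_next _).
- by rewrite -(size_listing i.+1) /= !size_cat size_listing leq_add2l leq_addr.
rewrite [take (start i) _]take_size_cat//= catA take_size_cat.
  by rewrite big_cat /= -/(listing i) addrAC subrr add0r /front big_filter.
by rewrite size_cat size_listing.
Qed.

End BlockRearrangement.

(** If the subsums were unbounded, every [N] would be followed by a block having a subsum of norm at
    least 1. Listing those subsums first in their blocks gives a rearrangement that is not
    Cauchy. *)
Lemma unconditionally_cvg_subsums_bounded (u : nat -> X) :
  unconditionally_cvg u -> exists2 M : R, 0 <= M &
  forall k (P : pred nat), rnorm (\sum_(j < k | P j) u j) <= M.
Proof.
move=> u_uncond; apply: contrapT => unbounded.
have step N : exists p : nat * pred nat, (N < p.1)%N /\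
    1 <= rnorm (\sum_(N <= j < p.1 | p.2 j) u j).
  apply: contrapT => nostep; apply: unbounded.
  (* [B] controls the indices below [N]; were all subsums beyond [N] below 1, then [B + 1] would
     bound every subsum. *)
  pose B : R := \sum_(0 <= j < N) rnorm (u j).
  have B_ge k (P : pred nat) : (k <= N)%N ->
      rnorm (\sum_(0 <= j < k | P j) u j) <= B.
    move=> kN; apply: le_trans (rnorm_sum _ _ _) _; rewrite /B.
    rewrite (big_cat_nat _ kN)//= -[leLHS]addr0 lerD//.
      rewrite big_mkcond ler_sum// => j _.
      by case: ifP => _; rewrite ?rnorm_ge0.
    by rewrite sumr_ge0// => j _; apply: rnorm_ge0.
  exists (B + 1) => [|k P].
    by rewrite addr_ge0// sumr_ge0// => j _; apply: rnorm_ge0.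
  rewrite -big_mkord; have [kN|Nk] := leqP k N.
    by apply: le_trans (B_ge k P kN) _; rewrite lerDl.
  rewrite (big_cat_nat _ (ltnW Nk))//=; apply: le_trans (rnormD _ _) _.
  rewrite lerD ?B_ge// leNgt; apply/negP => /ltW ge1.
  by apply: nostep; exists (k, P).
have [f fP] := choice step.
have [g [g_bij gP]] :=
  block_rearrangement (fun N => (f N).2) (fun N => (fP N).1) u.
(* Two partial sums within 1/3 of the limit differ by at most 2/3, less than 1. *)
have /cvg_ex[x /rnorm_cvgP/(_ 3^-1)] := u_uncond g g_bij.
rewrite invr_gt0 ltr0n => /(_ isT)[i hi].
have [m [n [im ni [N eqN]]]] := gP i.
have := (fP N).2; rewrite -eqN.
have := rnormDB x (series (u \o g) n) (series (u \o g) m).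
have := hi m im; have := hi n ni; rewrite [rnorm (x - _)]rnormB; lra.
Qed.

End UnconditionalConvergence.

(** * The weak [l_1] norm *)

Section WeakNorm.
Context {R : realType} {s : scalar_kind}.
Local Notation K := (scalars R s).
Context {X : completeNormedModType K}.

Lemma dual_ball_le (f : {linear X -> K^o}) x :
  dual_ball f -> modulus (f x : K) <= rnorm x.
Proof.
move=> [_ f1]; have [x_eq0|x_neq0] := eqVneq (rnorm x) 0.
  by rewrite (rnorm_eq0 x_eq0) linear0 modulus0 rnorm0.
have x_gt0 : 0 < rnorm x by rewrite lt_neqAle eq_sym x_neq0 rnorm_ge0.
have modE : modulus (of_real (rnorm x)^-1 : K) = (rnorm x)^-1.
  by rewrite modulus_of_real gtr0_norm ?invr_gt0.
have := f1 (of_real (rnorm x)^-1 *: x).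
rewrite linearZ /= !rnormE !rnormZ modE mulVf// of_real1 => /(_ (lexx _)).
by rewrite -(@of_real1 R s) ler_of_real rnorm_scalar mulrC ler_pdivrMr// mul1r.
Qed.

(** A functional of the dual ball maps subsums of [y] to subsums of its values without increasing
    the norm, so [sum_modulus_le_subsums] applies. *)
Lemma weak_norm1_le_subsums (y : nat -> X) k (M : R) :
  (forall P : pred nat, rnorm (\sum_(j < k | P j) y j) <= M) ->
  weak_norm 1 (fun j : 'I_k => y j) <= M *+ 4.
Proof.
move=> subM; rewrite /weak_norm; set A := image _ _.
have M_ge0 : 0 <= M by apply: le_trans (rnorm_ge0 _) (subM pred0).
(* [sup] of the empty set is 0 by convention. *)
have [->|/set0P A0] := eqVneq A set0; first by rewrite sup0 mulrn_wge0.
apply: ge_sup => // _ [f f_ball <-].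
rewrite invr1 powRr1 ?sumr_ge0// => [|j _]; last exact: powR_ge0.
under eq_bigr do rewrite powRr1 ?modulus_ge0//.
apply: (sum_modulus_le_subsums (f := fun j => f (y j))) => P.
by rewrite -linear_sum; apply: le_trans (dual_ball_le _ f_ball) (subM P).
Qed.

End WeakNorm.

(** * Elementary inequalities for powers *)

Section RealInequalities.
Context {R : realFieldType}.
Implicit Types x y : R.

Lemma exprD_le x y m : 0 <= x -> 0 <= y ->
  (x + y) ^+ m <= 2 ^+ m * (x ^+ m + y ^+ m).
Proof.
wlog xy : x y / x <= y => [hw x0 y0|x0 y0].
  have [/hw|/ltW/hw] := leP x y; first exact.
  by rewrite addrC [x ^+ m + _]addrC; apply.
apply: (@le_trans _ _ ((2 * y) ^+ m)).
  by rewrite lerXn2r ?nnegrE ?addr_ge0 ?mulr_ge0//; lra.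
by rewrite exprMn ler_pM2l ?exprn_gt0// lerDr exprn_ge0.
Qed.

(** Each factor is at most the largest one, whose [m]-th power is among the summands. *)
Lemma prod_le_sum_expr m (t : 'I_m -> R) : (0 < m)%N -> (forall i, 0 <= t i) ->
  \prod_i t i <= \sum_i t i ^+ m.
Proof.
case: m t => // m t _ t0.
have [i _ max_i] := arg_maxP t (erefl true : xpredT (ord0 : 'I_m.+1)).
apply: (@le_trans _ _ (t i ^+ m.+1)).
  rewrite -[X in _ ^+ X](card_ord m.+1) -prodr_const.
  by apply: ler_prod => j _; rewrite t0 /=; apply: max_i.
by rewrite (bigD1 i)//= lerDl sumr_ge0// => j _; rewrite exprn_ge0.
Qed.

(** The left side is a monomial of total degree [m], hence at most the [m]-th power of the
    maximum. *)
Lemma exprM3_le x y z (i m : nat) : 0 <= x -> 0 <= y -> 0 <= z -> (i < m)%N ->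
  z * (x ^+ (m.-1 - i) * y ^+ i) <= z ^+ m + x ^+ m + y ^+ m.
Proof.
case: m => // m x0 y0 z0; rewrite ltnS => im /=.
pose w := Num.max z (Num.max x y).
have zw : z <= w by rewrite le_max lexx.
have xw : x <= w by rewrite !le_max lexx orbT.
have yw : y <= w by rewrite !le_max lexx !orbT.
have w0 : 0 <= w by apply: le_trans zw.
apply: (@le_trans _ _ (w ^+ m.+1)).
  rewrite exprS -{2}(subnK im) exprD.
  by rewrite !ler_pM ?mulr_ge0 ?exprn_ge0// lerXn2r// nnegrE.
rewrite /w; have [_|_] := leP z (Num.max x y); last first.
  by rewrite -addrA lerDl addr_ge0// exprn_ge0.
have [_|_] := leP x y; first by rewrite lerDr addr_ge0// exprn_ge0.
by rewrite addrAC lerDr addr_ge0// exprn_ge0.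
Qed.

End RealInequalities.

(** * Diagonal polynomials and their continuity *)

Section DiagonalPolynomial.
Context {R : realType} {s : scalar_kind}.
Local Notation K := (scalars R s).
Context {X : completeNormedModType K}.
Variable b : nat -> X.
Hypothesis b_basis : schauder_basis b.
Hypothesis b_normalized : forall n, `|b n| = 1.
Variables (m : nat) (nu : nat -> R).
Hypothesis m_gt0 : (0 < m)%N.
Hypothesis nu_ge0 : forall j, 0 <= nu j.

Let Q k x : R := \sum_(0 <= j < k) nu j * modulus (coef b j x) ^+ m.

Hypothesis Q_finite : forall x, exists B, forall k, Q k x <= B.

Let Q_ge0 k x : 0 <= Q k x.
Proof.
by apply: sumr_ge0 => j _; rewrite mulr_ge0// exprn_ge0// modulus_ge0.
Qed.

Let modulusD (u v : K) : modulus (u + v) <= modulus u + modulus v.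
Proof. by have := @rnormD R s K^o u v; rewrite !rnorm_scalar. Qed.

Let modulusN (u : K) : modulus (- u) = modulus u.
Proof. by have := @rnormN R s K^o u; rewrite !rnorm_scalar. Qed.

Let QD k x y : Q k (x + y) <= 2 ^+ m * (Q k x + Q k y).
Proof.
rewrite /Q -big_split mulr_sumr /=; apply: ler_sum => j _.
rewrite -mulrDr mulrCA ler_wpM2l//.
apply: le_trans (exprD_le m (modulus_ge0 _) (modulus_ge0 _)).
by rewrite lerXn2r ?nnegrE ?addr_ge0 ?modulus_ge0// coef_funD.
Qed.

Let QZ k a x : Q k (a *: x) = modulus a ^+ m * Q k x.
Proof.
rewrite /Q mulr_sumr; apply: eq_bigr => j _.
by rewrite coef_funZ// modulusM exprMn mulrCA.
Qed.

Let QN k x : Q k (- x) = Q k x.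
Proof. by rewrite -scaleN1r QZ modulusN modulus1 expr1n mul1r. Qed.

(** Baire gives a uniform bound on a dense part of a ball; continuity of the coefficients extends it
    to the whole ball, [QD] moves the ball to the origin, and homogeneity does the rest. *)
Lemma diagonal_bounded : exists2 C : R, 0 <= C &
  forall k x, Q k x <= C * rnorm x ^+ m.
Proof.
have [C C0 coefC] := coef_bounded b_basis b_normalized.
pose A n := [set x | forall k, Q k x <= n%:R].
have cover x : exists n, A n x.
  have [B QB] := Q_finite x; have B0 : 0 <= B by apply: le_trans (QB 0%N).
  by exists (Num.bound B) => k; apply: le_trans (QB k) (ltW (archi_boundP B0)).
have [n [x0 [d [d0 near]]]] := rnorm_baire cover.
pose B := 2 ^+ m * (n%:R + 1) : R.
have Q_ball k x : rnorm (x - x0) <= d -> Q k x <= B.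
  move=> xd; pose V := \sum_(0 <= j < k) nu j.
  have V0 : 0 <= V by apply: sumr_ge0.
  (* The tolerance may depend on [k], since [B] does not: it makes [C * e] and [V * (C * e)] at most
     1, whence [Q k (x - a) <= 1]. *)
  have e0 : 0 < ((C + 1) * (V + 1))^-1 by rewrite invr_gt0 mulr_gt0// ltr_wpDl.
  have [a Aa] := near x xd _ e0; set e := _^-1 in e0 * => xa.
  have Ce1 : C * e <= 1.
    by rewrite ler_pdivrMr ?mul1r ?mulr_gt0 ?ltr_wpDl//; nra.
  have Qxa : Q k (x - a) <= 1.
    apply: (@le_trans _ _ (V * (C * e))); last first.
      rewrite /e mulrA ler_pdivrMr ?mul1r ?mulr_gt0 ?ltr_wpDl//; nra.
    rewrite /Q /V mulr_suml; apply: ler_sum => j _; rewrite ler_wpM2l//.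
    have le_Ce : modulus (coef b j (x - a)) <= C * e.
      by apply: le_trans (coefC _ _) _; rewrite ler_wpM2l.
    apply: le_trans (le_Ce); rewrite -[leRHS]expr1 ler_wiXn2l ?modulus_ge0//.
    exact: le_trans le_Ce Ce1.
  rewrite -[x](subrK a) addrC; apply: le_trans (QD _ _ _) _.
  by rewrite ler_pM2l ?exprn_gt0// lerD.
have Q_ball0 k h : rnorm h <= d -> Q k h <= 2 ^+ m * (B + B).
  move=> hd; rewrite -[h](addrK x0); apply: le_trans (QD _ _ _) _.
  rewrite QN ler_pM2l ?exprn_gt0// lerD ?Q_ball ?addrK//.
  by rewrite subrr rnorm0 ltW.
have B0 : 0 <= B by rewrite mulr_ge0 ?exprn_ge0 ?addr_ge0.
exists (2 ^+ m * (B + B) / d ^+ m) => [|k x].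
  by rewrite divr_ge0 ?mulr_ge0 ?addr_ge0 ?exprn_ge0// ltW.
have [x_eq0|x_neq0] := eqVneq (rnorm x) 0.
  rewrite (rnorm_eq0 x_eq0) -(scale0r x) QZ modulus0 rnormZ modulus0 mul0r.
  by rewrite expr0n gtn_eqF// mul0r mulr0.
have x_gt0 : 0 < rnorm x by rewrite lt_neqAle eq_sym x_neq0 rnorm_ge0.
have modE : modulus (of_real (d / rnorm x) : K) = d / rnorm x.
  by rewrite modulus_of_real gtr0_norm ?divr_gt0.
have := Q_ball0 k (of_real (d / rnorm x) *: x).
rewrite QZ rnormZ modE divfK// => /(_ (lexx _)).
rewrite expr_div_n mulrAC ler_pdivrMr ?exprn_gt0// => QE.
by rewrite [leRHS]mulrAC ler_pdivlMr ?exprn_gt0// mulrC.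
Qed.

Let form_partial k (v : 'I_m -> X) : K^o :=
  \sum_(0 <= j < k) of_real (nu j) * \prod_i coef b j (v i).

(** By [prod_le_sum_expr] the increments are dominated by those of [G], a bounded nondecreasing
    sequence. *)
Let form_partial_cvg v : cvgn (form_partial ^~ v).
Proof.
pose G k := \sum_i Q k (v i).
have Q_nd x : nondecreasing_seq (Q ^~ x).
  move=> k l kl; rewrite /Q (big_cat_nat _ kl)//= lerDl.
  by apply: sumr_ge0 => j _; rewrite mulr_ge0// exprn_ge0// modulus_ge0.
have G_nd : nondecreasing_seq G.
  by move=> k l kl; apply: ler_sum => i _; apply: Q_nd.
have /cvg_ex[g /(@rnorm_cvgP R RealScalars R^o) Gg] : cvgn (G : nat -> R^o).
  apply: nondecreasing_is_cvgn => //.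
  have [B QB] := choice Q_finite.
  by exists (\sum_i B (v i)) => _ [k _ <-]; apply: ler_sum => i _; apply: QB.
have tail k l : (k <= l)%N ->
    rnorm (form_partial l v - form_partial k v) <= G l - G k.
  move=> kl; have -> : form_partial l v = form_partial k v +
      \sum_(k <= j < l) (of_real (nu j) * \prod_i coef b j (v i) : K^o).
    by rewrite /form_partial (big_cat_nat _ kl).
  rewrite addrC addKr.
  apply: le_trans (rnorm_sum _ _ _) _.
  have QB x : Q l x - Q k x =
      \sum_(k <= j < l) nu j * modulus (coef b j x) ^+ m.
    by rewrite /Q (big_cat_nat _ kl)// addrAC subrr add0r.
  rewrite /G -sumrB; under [leRHS]eq_bigr do rewrite QB.
  rewrite exchange_big /=; apply: ler_sum => j _; rewrite rnorm_scalar.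
  rewrite -mulr_sumr modulusM modulus_of_real ger0_norm// ler_wpM2l//.
  by rewrite modulus_prod prod_le_sum_expr// => i; apply: modulus_ge0.
apply: scalars_complete => e e0.
have [N hN] := Gg (e / 2) (divr_gt0 e0 (ltr0Sn _ 1)); exists N.
have close k l : (N <= k)%N -> (N <= l)%N -> G l - G k <= e.
  move=> Nk Nl; have := hN k Nk; have := hN l Nl.
  rewrite !(@rnorm_scalar R RealScalars) /= !ler_norml.
  move=> /andP[_ h1] /andP[h2 _]; lra.
move=> k l Nk Nl; have [kl|/ltnW lk] := leqP k l.
  by rewrite rnormB; apply: le_trans (tail _ _ kl) (close _ _ Nk Nl).
exact: le_trans (tail _ _ lk) (close _ _ Nl Nk).
Qed.

Let form v : K := limn (form_partial ^~ v).

Let form_multilinear : multilinear form.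
Proof.
move=> i v a x y; set w := fun z j => if j == i then z else v j.
have prodE z j : \prod_k coef b j (w z k) =
    coef b j z * \prod_(k | k != i) coef b j (v k).
  rewrite (bigD1 i)//= {1}/w eqxx; congr (_ * _).
  by apply: eq_bigr => k /negPf ki; rewrite /w ki.
rewrite -[LHS]/(limn (form_partial ^~ (w (a *: x + y)))).
have -> : form_partial ^~ (w (a *: x + y)) =
    (fun k => a *: form_partial k (w x) + form_partial k (w y)).
  apply/funext => k; rewrite /form_partial scaler_sumr -big_split /=.
  apply: eq_bigr => j _; rewrite !prodE coef_linear//.
  rewrite mulrDl mulrDr; congr (_ + _).
  by rewrite [a *: coef b j x]/(a * _) -mulrA mulrCA.
apply: cvg_lim; first exact: norm_hausdorff.
apply: cvgD; last exact: form_partial_cvg.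
by apply: cvgZl_tmp; apply: form_partial_cvg.
Qed.

(** A local Lipschitz estimate. Factor [x_j^m - y_j^m] and write [x - y = r z] with [z] of norm 1;
    [exprM3_le] bounds the sum by [m r (Q k z + Q k x + Q k y)], and [diagonal_bounded] applies. The
    1 in the bound is the [m]-th power of the norm of [z]. *)
Let form_continuous : continuous (fun x => form (fun=> x)).
Proof.
have [C C0 QC] := diagonal_bounded.
have diff k x y : rnorm (form_partial k (fun=> x) - form_partial k (fun=> y)) <=
    m%:R * rnorm (x - y) * (C * (1 + rnorm x ^+ m + rnorm y ^+ m)).
  have [xy0|xy_neq0] := eqVneq (rnorm (x - y)) 0.
    have /eqP := rnorm_eq0 xy0; rewrite subr_eq0 => /eqP ->.
    by rewrite !subrr !rnorm0 mulr0 mul0r.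
  have xy_gt0 : 0 < rnorm (x - y) by rewrite lt_neqAle eq_sym xy_neq0 rnorm_ge0.
  set r := rnorm (x - y) in xy_neq0 xy_gt0 *.
  pose z := of_real r^-1 *: (x - y).
  have z1 : rnorm z = 1.
    by rewrite rnormZ modulus_of_real gtr0_norm ?invr_gt0// -/r mulVf.
  apply: (@le_trans _ _ (m%:R * r * (Q k z + Q k x + Q k y))); last first.
    rewrite ler_wpM2l ?mulr_ge0 ?(ltW xy_gt0)// !mulrDr.
    by rewrite !lerD// -(expr1n _ m) -z1.
  rewrite /form_partial -sumrB /Q -!big_split mulr_sumr /=.
  apply: le_trans (rnorm_sum _ _ _) _; apply: ler_sum => j _.
  rewrite rnorm_scalar -mulrBr modulusM modulus_of_real ger0_norm//.
  rewrite -!mulrDr mulrCA ler_wpM2l// !prodr_const card_ord subrXX modulusM.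
  have -> : modulus (coef b j x - coef b j y) = r * modulus (coef b j z).
    rewrite /z coef_funZ// coef_funB// modulusM modulus_of_real.
    by rewrite gtr0_norm ?invr_gt0// mulVKf.
  rewrite -[m%:R * r * _]mulrA [m%:R * _]mulrC -!mulrA ler_pM2l//.
  have sum_le :
      modulus (\sum_(i < m) coef b j x ^+ (m.-1 - i) * coef b j y ^+ i) <=
      \sum_(i < m)
        modulus (coef b j x) ^+ (m.-1 - i) * modulus (coef b j y) ^+ i.
    rewrite -[leLHS]rnorm_scalar; apply: le_trans (rnorm_sum _ _ _) _.
    by apply: ler_sum => i _; rewrite rnorm_scalar modulusM !modulusX.
  apply: le_trans (ler_wpM2l (modulus_ge0 _) sum_le) _.
  rewrite mulr_sumr mulr_natr -[X in _ *+ X]card_ord -sumr_const.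
  by apply: ler_sum => i _; apply: exprM3_le; rewrite ?modulus_ge0.
have form_diff x y : rnorm ((form (fun=> x) : K^o) - form (fun=> y)) <=
    m%:R * rnorm (x - y) * (C * (1 + rnorm x ^+ m + rnorm y ^+ m)).
  rewrite -[X in rnorm X]subr0.
  apply: (@cvg_rnorm_le _ _ _
    (fun k => form_partial k (fun=> x) - form_partial k (fun=> y)) _ 0 _ 0%N).
    by apply: cvgB; apply: form_partial_cvg.
  by move=> k _; rewrite subr0.
move=> x; apply/(@rnorm_continuousP _ _ _ K^o) => e e0.
(* Lipschitz constant at [x] within distance 1, where [rnorm y <= rnorm x + 1]; dividing by [L + 1]
   is safe even if [L = 0]. *)
pose L := m%:R * (C * (1 + rnorm x ^+ m + (rnorm x + 1) ^+ m)).
have L0 : 0 <= L.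
  by rewrite !mulr_ge0// !addr_ge0// exprn_ge0 ?addr_ge0 ?rnorm_ge0.
have L1 : 0 < L + 1 by rewrite ltr_wpDl.
exists (Num.min 1 (e / (L + 1))) => [|y].
  by rewrite lt_min ltr01 divr_gt0.
rewrite le_min => /andP[xy1 xye]; apply: le_trans (form_diff x y) _.
apply: (@le_trans _ _ (L * rnorm (x - y))).
  rewrite mulrAC /L -!mulrA ler_wpM2l// !mulrA ler_wpM2r ?rnorm_ge0//.
  rewrite ler_wpM2l// lerD2l lerXn2r ?nnegrE ?addr_ge0 ?rnorm_ge0//.
  rewrite -[y](subrK x) addrC; apply: le_trans (rnormD _ _) _.
  by rewrite lerD2l rnormB.
apply: (@le_trans _ _ ((L + 1) * rnorm (x - y))).
  by rewrite ler_wpM2r ?rnorm_ge0// lerDl.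
by rewrite mulrC -ler_pdivlMr.
Qed.

Lemma diagonal_polynomial : exists P : X -> K, polynomials X m P /\
  forall a j, P (a *: b j) = of_real (nu j) * a ^+ m.
Proof.
exists (fun x => form (fun=> x)); split.
  split; first exact: form_continuous.
  by exists form; first exact: form_multilinear.
move=> a j; apply: (@cvg_lim K^o); first exact: norm_hausdorff.
(* Truncations are constant from [j.+1] on, the first one to contain the index [j]. *)
apply/rnorm_cvgP => e e0; exists j.+1 => k jk.
suff -> : form_partial k (fun=> a *: b j) = of_real (nu j) * a ^+ m.
  by rewrite subrr rnorm0 ltW.
rewrite /form_partial big_mkord (bigD1 (Ordinal jk))//=.
rewrite [X in _ + X]big1 => [|i].
  by rewrite [LHS]addr0 prodr_const card_ord coefZ_basis// eqxx mulr1.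
rewrite -val_eqE /= => /negPf ij.
rewrite (bigD1 (Ordinal m_gt0))//= coefZ_basis// ij.
by rewrite mulr0 mul0r mulr0.
Qed.

End DiagonalPolynomial.

(** * Summability and the Abel-Dini argument *)

Section Summability.
Context {R : realType}.
Implicit Types (c u nu : nat -> R) (q : R).

(** Bounded partial sums: for nonnegative terms this amounts to convergence. *)
Definition summable u := exists B, forall k, \sum_(0 <= j < k) u j <= B.

Lemma summable_cvg u : (forall j, 0 <= u j) -> summable u -> cvgn (series u).
Proof.
move=> u0 [B uB]; apply: nondecreasing_is_cvgn.
  exact: nondecreasing_series.
by exists B => _ [k _ <-]; apply: uB.
Qed.

(** Combine [exp y >= 1 + y] at [y = - d * ln x] with [ln x <= x - 1]. *)
Lemma tangent_powR (x d : R) : 0 < x <= 1 -> 0 < d ->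
  d * (1 - x) <= x `^ (- d) - 1.
Proof.
move=> /andP[x0 x1] d0; rewrite /powR gt_eqF//.
have lnx : ln x <= x - 1.
  by have := @le_ln1Dx R (x - 1); rewrite [1 + _]addrC subrK; apply; lra.
have := expR_ge1Dx (- d * ln x).
have := ler_wpM2l (ltW d0) lnx; lra.
Qed.

(* Abel-Dini: with T the partial sums of 1 + \sum c, the series \sum c / T^p
   converges for p > 1 while \sum c / T diverges. *)
Lemma summable_of_weights c q : 0 < q -> q < 1 -> (forall j, 0 <= c j) ->
  (forall nu, (forall j, 0 <= nu j) -> summable nu ->
     summable (fun j => nu j `^ q * c j `^ (1 - q))) ->
  summable c.
Proof.
move=> q0 q1 c0 weights.
pose T k := 1 + \sum_(0 <= j < k) c j.
have TS k : T k.+1 = T k + c k by rewrite /T big_nat_recr//= addrA.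
have T_ge1 k : 1 <= T k by rewrite lerDl sumr_ge0.
have T0 k : 0 < T k by apply: lt_le_trans (T_ge1 k).
have T_nd k l : (k <= l)%N -> T k <= T l.
  by move=> kl; rewrite /T lerD2l (big_cat_nat _ kl)//= lerDl sumr_ge0.
pose d := q^-1 - 1; have d0 : 0 < d by rewrite subr_gt0 invf_gt1.
(* The exponent is [p = 1 / q > 1], for which [nu^q * c^(1-q)] is exactly [c j / T j.+1]. *)
pose nu j := c j * T j.+1 `^ (- q^-1).
have nu0 j : 0 <= nu j by rewrite mulr_ge0 ?powR_ge0.
(* Telescoping bound: the tangent inequality at [T j / T j.+1], multiplied by [T j.+1] to the power
   [- d]. *)
have nu_le j : nu j <= d^-1 * (T j `^ (- d) - T j.+1 `^ (- d)).
  have /(tangent_powR)/(_ d0) : 0 < T j / T j.+1 <= 1.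
    by rewrite divr_gt0//= ler_pdivrMr// mul1r T_nd.
  rewrite ler_pdivlMl// => tg.
  have -> : nu j = T j.+1 `^ (- d) * (1 - T j / T j.+1).
    rewrite /nu (_ : - q^-1 = - d - 1); last by rewrite /d; ring.
    rewrite powRD ?(gt_eqF (T0 _)) ?implybT// powR_inv1 ?(ltW (T0 _))// mulrCA.
    congr (_ * _).
    have -> : c j = T j.+1 - T j by rewrite TS addrC addKr.
    by rewrite mulrBl divff ?gt_eqF ?T0.
  rewrite mulrCA; apply: le_trans (ler_wpM2l (powR_ge0 _ _) tg) _.
  rewrite mulrBr mulr1 -powRM ?divr_ge0 ?(ltW (T0 _))// mulrCA.
  by rewrite divff ?(gt_eqF (T0 _))// mulr1.
have nu_sum : summable nu.
  exists d^-1 => k.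
  apply: (@le_trans _ _ (d^-1 * (T 0%N `^ (- d) - T k `^ (- d)))).
    elim: k => [|k IH]; first by rewrite big_geq// subrr mulr0.
    by rewrite big_nat_recr//=; have := nu_le k; lra.
  rewrite -[leRHS]mulr1 ler_pM2l ?invr_gt0// /T big_geq// addr0 powR1.
  by rewrite gerBl powR_ge0.
have [B sumB] := weights nu nu0 nu_sum.
have WE j : nu j `^ q * c j `^ (1 - q) = c j / T j.+1.
  rewrite /nu powRM ?powR_ge0// -powRrM mulNr mulVf ?gt_eqF//.
  rewrite powR_inv1 ?(ltW (T0 _))// mulrAC; congr (_ / _).
  rewrite -powRD; first by rewrite addrC subrK powRr1.
  by rewrite addrC subrK oner_eq0.
pose W k := \sum_(0 <= j < k) c j / T j.+1.
have WB k : W k <= B.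
  by apply: le_trans (sumB k); apply: ler_sum => j _; rewrite WE.
have /(@rnorm_cvgP R RealScalars R^o)/(_ 4^-1) :
    (W : nat -> R^o) @ \oo --> limn W.
  by apply: summable_cvg => [j|]; [rewrite divr_ge0 ?(ltW (T0 _)) | exists B].
rewrite invr_gt0 ltr0n => /(_ isT)[N hN].
exists (2 * T N) => k; apply: (@le_trans _ _ (T k)); first by rewrite /T lerDr.
have [kN|/ltnW Nk] := leqP k N.
  by apply: le_trans (T_nd _ _ kN) _; have := T0 N; lra.
(* Every denominator is at most [T k]. As the right side is at most 1/2, this forces
   [T k <= 2 * T N]. *)
have tail : (T k - T N) / T k <= W k - W N.
  rewrite /W (big_cat_nat _ Nk)// [leRHS]addrAC subrr add0r.
  have -> : T k - T N = \sum_(N <= j < k) c j.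
    rewrite /T (big_cat_nat _ Nk)// opprD addrACA subrr add0r.
    by rewrite addrAC subrr add0r.
  rewrite mulr_suml; apply: ler_sum_nat => j /andP[_ jk].
  by rewrite ler_wpM2l// lef_pV2 ?posrE// T_nd.
have WW : W k - W N <= 2^-1.
  have := hN k Nk; have := hN N (leqnn N).
  rewrite !(@rnorm_scalar R RealScalars) /= !ler_norml.
  move=> /andP[h1 _] /andP[_ h2]; lra.
have := le_trans tail WW; rewrite ler_pdivrMr//; lra.
Qed.

End Summability.

(** * Consequences of every polynomial being summing *)

Section SummingPolynomials.
Context {R : realType} {s : scalar_kind}.
Local Notation K := (scalars R s).
Context {X : completeNormedModType K}.
Variable b : nat -> X.
Hypothesis b_basis : unconditional_basis b.
Hypothesis b_normalized : forall n, `|b n| = 1.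
Variables (m : nat) (q : R).
Hypotheses (m_gt0 : (0 < m)%N) (q_gt0 : 0 < q).
Hypothesis all_summing : summing_polynomials X m q 1 = polynomials X m.

Let a x j : R := modulus (coef b j x).

Let a_ge0 x j : 0 <= a x j.
Proof. exact: modulus_ge0. Qed.

Lemma weak_norm_ge0 (r : R) k (y : 'I_k -> X) : 0 <= weak_norm r y.
Proof.
rewrite /weak_norm; set A := image _ _.
(* [sup] takes the default value 0 when there is no supremum. *)
have [supA|/sup_out -> //] := pselect (has_sup A).
have [_ [f f_ball _]] := supA.1.
apply: le_trans (ub_le_sup supA.2 _); last by exists f.
exact: powR_ge0.
Qed.

(** The diagonal polynomial is tested on the vectors [x_j b_j], whose weak norm is at most [4 M]
    whatever their number. *)
Lemma summable_diagonal (nu : nat -> R) : (forall j, 0 <= nu j) ->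
  (forall x, summable (fun j => nu j * a x j ^+ m)) ->
  forall x, summable (fun j => (nu j * a x j ^+ m) `^ q).
Proof.
move=> nu0 nu_sum x.
have [P [Ppoly PE]] :=
  diagonal_polynomial b_basis.1 b_normalized m_gt0 nu0 nu_sum.
have [_ [L L0 PL]] : summing_polynomials X m q 1 P by rewrite all_summing.
have [M M0 subM] := unconditionally_cvg_subsums_bounded (b_basis.2 x).
exists ((L * (M *+ 4) ^+ m) `^ q) => k; rewrite big_mkord.
have := PL k (fun j => coef b j x *: b j).
under eq_bigr do rewrite PE modulusM modulus_of_real ger0_norm// modulusX.
set S := \sum_(j < k) _ => SL.
have S0 : 0 <= S by apply: sumr_ge0 => j _; apply: powR_ge0.
rewrite -[S]powRr1// -[X in S `^ X](mulVf (lt0r_neq0 q_gt0)) powRrM.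
rewrite ge0_ler_powR ?(ltW q_gt0) ?nnegrE ?powR_ge0//.
  by rewrite mulr_ge0 ?exprn_ge0 ?mulrn_wge0.
apply: le_trans SL _; rewrite ler_wpM2l// lerXn2r ?nnegrE ?mulrn_wge0//.
  exact: weak_norm_ge0.
exact: (@weak_norm1_le_subsums _ _ _ (fun j => coef b j x *: b j)).
Qed.

(** The exponent is such that its product with [1 - q] is [m q], so the hypothesis of
    [summable_of_weights] is what [summable_diagonal] provides. *)
Lemma summable_coef x : q < 1 ->
  summable (fun j => a x j `^ (m%:R * q / (1 - q))).
Proof.
move=> q1; have q1' : 0 < 1 - q by rewrite subr_gt0.
apply: (@summable_of_weights _ _ q) => // [j|nu nu0 [B nuB]].
  exact: powR_ge0.
have [C C0 coefC] := coef_bounded b_basis.1 b_normalized.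
have nu_sum y : summable (fun j => nu j * a y j ^+ m).
  exists (B * (C * rnorm y) ^+ m) => k.
  apply: (@le_trans _ _ ((\sum_(0 <= j < k) nu j) * (C * rnorm y) ^+ m)).
    rewrite mulr_suml; apply: ler_sum => j _; rewrite ler_wpM2l//.
    by rewrite lerXn2r ?nnegrE ?a_ge0 ?mulr_ge0 ?rnorm_ge0//; apply: coefC.
  by rewrite ler_wpM2r ?exprn_ge0 ?mulr_ge0 ?rnorm_ge0.
have [B' sumB'] := summable_diagonal nu0 nu_sum x.
exists B' => k; apply: le_trans (sumB' k); apply: ler_sum => j _.
rewrite powRM ?exprn_ge0// -powR_mulrn// -!powRrM.
by rewrite divfK ?gt_eqF.
Qed.

Lemma summable_coef_half x : q <= 2^-1 ->
  summable (fun j => a x j `^ (m%:R * q)).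
Proof.
move=> q2; have q1 : q < 1 by lra.
set r := m%:R * q / (1 - q).
have r_le : r <= m%:R by rewrite ler_pdivrMr ?subr_gt0// ler_wpM2l//; lra.
have [C C0 coefC] := coef_bounded b_basis.1 b_normalized.
have pow_sum y : summable (fun j => 1 * a y j ^+ m).
  have [B sumB] := summable_coef y q1.
  (* Since [r <= m], the [m]-th power of a coefficient is its [r]-th power times a factor bounded by
     [D]. *)
  pose D := (C * rnorm y) `^ (m%:R - r).
  exists (B * D) => k.
  apply: (@le_trans _ _ ((\sum_(0 <= j < k) a y j `^ r) * D)); last first.
    by rewrite ler_wpM2r ?powR_ge0.
  rewrite mulr_suml; apply: ler_sum => j _; rewrite mul1r -powR_mulrn//.
  rewrite -[X in _ `^ X <= _](subrK r) addrC powRD; last first.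
    by rewrite addrC subrK pnatr_eq0 gtn_eqF.
  rewrite ler_wpM2l ?powR_ge0//.
  rewrite ge0_ler_powR ?nnegrE ?subr_ge0 ?mulr_ge0 ?rnorm_ge0//.
  exact: coefC.
have [B' sumB'] := summable_diagonal (fun=> ler01) pow_sum x.
exists B' => k; apply: le_trans (sumB' k); apply: ler_sum => j _.
by rewrite mul1r -powR_mulrn// -powRrM.
Qed.

Lemma best_exponent_le (t : R) : 0 < t ->
  (forall x, summable (fun j => a x j `^ t)) -> (best_exponent b <= t%:E)%E.
Proof.
move=> t0 sum_t; apply: ereal_inf_lbound; exists t => //; split=> // x.
by apply: summable_cvg (sum_t x) => j; apply: powR_ge0.
Qed.

End SummingPolynomials.

Theorem theorem5 (R : realType) (s : scalar_kind)
    (X : completeNormedModType (scalars R s))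
    (Xinf : infinite_dimensional X)
    (b : nat -> X) (b_basis : unconditional_basis b)
    (b_normalized : forall n, `|b n| = 1)
    (m : nat) (m_gt0 : (0 < m)%N) (q : R) (q_gt0 : 0 < q)
    (all_summing : summing_polynomials X m q 1 = polynomials X m) :
  (q < 1 -> (best_exponent b <= (m%:R * q / (1 - q))%:E)%E) /\
  (q <= 2^-1 -> (best_exponent b <= (m%:R * q)%:E)%E).
Proof.
have mq_gt0 : 0 < m%:R * q by rewrite mulr_gt0// ltr0n.
split=> q_le.
  apply: (best_exponent_le (t := m%:R * q / (1 - q))) => [|x].
    by rewrite divr_gt0// subr_gt0.
  exact: (summable_coef b_basis b_normalized).
apply: (best_exponent_le (t := m%:R * q)) => // x.
exact: (summable_coef_half b_basis b_normalized).
Qed.
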